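(* Let $R$ be a commutative computable ring and let $\mathfrak{m}=\langle m_1,\ldots,m_k\rangle$ be a finitely generated maximal ideal in $R$. Then the localization $R_{\mathfrak{m}}$ of $R$ at $\mathfrak{m}$ is a computable ring.
   Context: Rings are associative with $1$. All matrices are finite (with sizes allowed to be $0$). **Generating syzygies.** For a matrix $A\in R^{r_1\times r_0}$, a matrix $X\in R^{r_2\times r_1}$ is a matrix of generating syzygies (of the rows) of $A$ if the rows of $X$ form a generating set of the kernel of the map $R^{1\times r_1}\to R^{1\times r_0}$, $x\mapsto xA$. One writes $X=\mathtt{SyzygiesGenerators}(A)$. **Deciding zero effectively.** For $A\in R^{r_1\times r_0}$ and $B\in R^{r_2\times r_0}$, one writes $(N,T)=\mathtt{DecideZeroEffectively}(A,B)$ for matrices $N\in R^{r_2\times r_0}$, $T\in R^{r_2\times r_1}$ with $N=TA+B$ and such that: whenever the $i$-th row of $B$ is an $R$-linear combination of the rows of $A$, the $i$-th row of $N$ is zero. (Hence $XA=B$ is solvable if and only if $N=0$, and then $X=-T$ is a solution.) **Computable ring.** A ring $R$ is left computable if any finite dimensional inhomogeneous linear system $XA=B$ over $R$ is effectively solvable in the following sense: there exist algorithms computing $\mathtt{SyzygiesGenerators}(A)$ and $\mathtt{DecideZeroEffectively}(A,B)$ for all matrices $A,B$ over $R$ with the same number of columns. Right computable is defined analogously for systems $AX=B$. A ring is computable if it is left and right computable. **Localization.** $R_{\mathfrak m}=S^{-1}R$ with $S=R\setminus\mathfrak m$, i.e. fractions $\frac{r}{s}$ with $r\in R$, $s\in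 S$, where $\frac rs\sim\frac{r'}{s'}$ iff $0\in (rs'-sr')\cdot S$. *)

(* Defs.v *)
From HB Require Import structures.
From Stdlib Require List.
From mathcomp Require Import all_boot all_order all_algebra.
From mathcomp Require Import ring.
From mathcomp Require Import boolp.

Set Implicit Arguments.
Unset Strict Implicit.
Unset Printing Implicit Defensive.

Import GRing.Theory.
Local Open Scope ring_scope.
Local Open Scope quotient_scope.

(* Kleene's general recursive functions: the least class of total functions
   containing zero, successor and projections and closed under composition,
   primitive recursion and regular minimization.  A k-ary function takes its
   arguments as a list; missing entries read as 0 and entries beyond the k-th
   are ignored, so that no arity has to be recorded. *)
Inductive recursive : (seq nat -> nat) -> Prop :=
| rec_zero : recursive (fun _ => 0%N)
| rec_succ : recursive (fun s => (nth 0%N s 0).+1)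
| rec_proj (i : nat) : recursive (fun s => nth 0%N s i)
| rec_comp (f : seq nat -> nat) (gs : seq (seq nat -> nat)) :
    recursive f -> (forall g, List.In g gs -> recursive g) ->
    recursive (fun s => f [seq g s | g <- gs])
| rec_prim (f g : seq nat -> nat) :
    recursive f -> recursive g ->
    recursive (fun s => iteri (nth 0%N s 0)
                          (fun n r => g [:: n, r & behead s]) (f (behead s)))
| rec_min (f : seq nat -> nat) (ex : forall s, exists n, f (n :: s) == 0%N) :
    recursive f -> recursive (fun s => ex_minn (ex s))
| rec_ext (f g : seq nat -> nat) : f =1 g -> recursive f -> recursive g.

Definition recursive1 (f : nat -> nat) : Prop :=
  recursive (fun s => f (nth 0%N s 0)).

Definition recursive2 (f : nat -> nat -> nat) : Prop :=
  recursive (fun s => f (nth 0%N s 0) (nth 0%N s 1)).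

Section ComputableRing.

Variable R : pzRingType.

Definition left_syzygies_generators (r0 r1 r2 : nat)
    (A : 'M[R]_(r1, r0)) (X : 'M[R]_(r2, r1)) : Prop :=
  forall x : 'rV[R]_r1, x *m A = 0 <-> exists y : 'rV[R]_r2, x = y *m X.

Definition left_decide_zero (r0 r1 r2 : nat)
    (A : 'M[R]_(r1, r0)) (B N : 'M[R]_(r2, r0)) (T : 'M[R]_(r2, r1)) : Prop :=
  N = T *m A + B /\
  forall i : 'I_r2,
    (exists x : 'rV[R]_r1, row i B = x *m A) -> row i N = 0.

Definition right_syzygies_generators (r0 r1 r2 : nat)
    (A : 'M[R]_(r0, r1)) (X : 'M[R]_(r1, r2)) : Prop :=
  forall x : 'cV[R]_r1, A *m x = 0 <-> exists y : 'cV[R]_r2, x = X *m y.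

Definition right_decide_zero (r0 r1 r2 : nat)
    (A : 'M[R]_(r0, r1)) (B N : 'M[R]_(r0, r2)) (T : 'M[R]_(r1, r2)) : Prop :=
  N = A *m T + B /\
  forall j : 'I_r2,
    (exists x : 'cV[R]_r1, col j B = A *m x) -> col j N = 0.

(* Algorithms act on codes of ring elements: nu c is the element coded by c.
   Every natural number is a code, and an element may have several codes. *)
Variable nu : nat -> R.

(* A matrix is coded by its two sizes followed by codes of its entries, row by
   row; the sizes are needed because either of them may be 0. *)
Definition codes_mx (p q c : nat) (A : 'M[R]_(p, q)) : Prop :=
  exists E : 'M[nat]_(p, q),
    A = map_mx nu E /\
    c = CodeSeq.code
          [:: p, q & [seq E i j | i <- enum 'I_p, j <- enum 'I_q]].

Definition effective_arithmetic : Prop :=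
  [/\ forall x : R, exists c, nu c = x,
      exists2 f, recursive2 f & forall a b, nu (f a b) = nu a + nu b,
      exists2 f, recursive1 f & forall a, nu (f a) = - nu a,
      exists2 f, recursive2 f & forall a b, nu (f a b) = nu a * nu b
    & exists2 f, recursive2 f & forall a b, f a b = 0%N <-> nu a = nu b].

Definition left_computable : Prop :=
  (exists2 f, recursive1 f &
     forall (r1 r0 : nat) (A : 'M[R]_(r1, r0)) (a : nat), codes_mx a A ->
       exists (r2 : nat) (X : 'M[R]_(r2, r1)),
         left_syzygies_generators A X /\ codes_mx (f a) X) /\
  (exists f g, [/\ recursive2 f, recursive2 g &
     forall (r1 r0 r2 : nat) (A : 'M[R]_(r1, r0)) (B : 'M[R]_(r2, r0))
       (a b : nat), codes_mx a A -> codes_mx b B ->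
       exists (N : 'M[R]_(r2, r0)) (T : 'M[R]_(r2, r1)),
         [/\ left_decide_zero A B N T, codes_mx (f a b) N
           & codes_mx (g a b) T]]).

Definition right_computable : Prop :=
  (exists2 f, recursive1 f &
     forall (r0 r1 : nat) (A : 'M[R]_(r0, r1)) (a : nat), codes_mx a A ->
       exists (r2 : nat) (X : 'M[R]_(r1, r2)),
         right_syzygies_generators A X /\ codes_mx (f a) X) /\
  (exists f g, [/\ recursive2 f, recursive2 g &
     forall (r0 r1 r2 : nat) (A : 'M[R]_(r0, r1)) (B : 'M[R]_(r0, r2))
       (a b : nat), codes_mx a A -> codes_mx b B ->
       exists (N : 'M[R]_(r0, r2)) (T : 'M[R]_(r1, r2)),
         [/\ right_decide_zero A B N T, codes_mx (f a b) N
           & codes_mx (g a b) T]]).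

(* The algorithms for linear systems presuppose that the elements of the ring
   can be represented, computed with and compared. *)
Definition computable_ring : Prop :=
  [/\ effective_arithmetic, left_computable & right_computable].

End ComputableRing.

Section Ideals.

Variable R : comNzRingType.

(* idealr_closed includes properness: 1 \notin I. *)
Definition maximal_ideal (m : {pred R}) : Prop :=
  idealr_closed m /\
  forall I : {pred R}, idealr_closed I -> {subset m <= I} -> I =i m.

Definition generates_ideal (k : nat) (g : 'I_k -> R) (m : {pred R}) : Prop :=
  forall x : R, x \in m <-> exists a : 'I_k -> R, x = \sum_i a i * g i.

Variables (m : {pred R}) (hm : maximal_ideal m).

Lemma maximal_compl1 : 1 \notin m.
Proof. by case: hm => -[]. Qed.

Lemma maximal0 : 0 \in m.
Proof. by case: hm => -[]. Qed.

Lemma maximal_complM (u v : R) : u \notin m -> v \notin m -> u * v \notin m.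
Proof.
case: hm => -[m0 m1 mD] hmax um vm; apply/negP => uvm.
pose J : {pred R} :=
  fun x => `[< exists r, exists2 y, y \in m & x = r * u + y >].
have inJ x : reflect (exists r, exists2 y, y \in m & x = r * u + y) (x \in J).
  exact: asboolP.
have mJ : {subset m <= J}.
  by move=> x xm; apply/inJ; exists 0; exists x => //; rewrite mul0r add0r.
have uJ : u \in J by apply/inJ; exists 1, 0 => //; rewrite mul1r addr0.
have J1 : 1 \notin J.
  apply/inJ => -[r [y ym e]]; move/negP: vm; apply.
  have -> : v = r * (u * v) + v * y.
    by rewrite mulrA [v * y]mulrC -mulrDl -e mul1r.
  by apply: (mD) => //; rewrite -[_ * _]addr0; apply: (mD).
have Jid : idealr_closed J.
  split=> //; first exact: mJ.
  move=> a x y /inJ[r [x' x'm ->]] /inJ[s [y' y'm ->]]; apply/inJ.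
  exists (a * r + s), (a * x' + y'); first exact: (mD).
  by rewrite mulrDr mulrA mulrDl addrACA.
by move: um; rewrite -(hmax J Jid mJ) uJ.
Qed.

End Ideals.

Section Localization.

Variables (R : comNzRingType) (m : {pred R}) (hm : maximal_ideal m).

Local Notation denom := {s : R | s \notin m}.
Local Notation pair := (R * denom)%type.

Definition loc_denom1 : denom := exist _ 1 (maximal_compl1 hm).
Definition loc_denomM (s t : denom) : denom :=
  exist _ (val s * val t) (maximal_complM hm (valP s) (valP t)).

Definition loc_equivf (x y : pair) : bool :=
  `[< exists2 t, t \notin m & (x.1 * val y.2 - val x.2 * y.1) * t = 0 >].

Lemma loc_equivfP (x y : pair) :
  reflect (exists2 t, t \notin m & (x.1 * val y.2 - val x.2 * y.1) * t = 0)
          (loc_equivf x y).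
Proof. exact: asboolP. Qed.

Lemma loc_equivf_refl : reflexive loc_equivf.
Proof.
move=> x; apply/loc_equivfP; exists 1; first exact: maximal_compl1 hm.
by rewrite [val x.2 * _]mulrC subrr mul0r.
Qed.

Lemma loc_equivf_symW x y : loc_equivf x y -> loc_equivf y x.
Proof.
move=> /loc_equivfP[t tm e]; apply/loc_equivfP; exists t => //.
by rewrite -[_ - _]opprB mulNr [val y.2 * _]mulrC [y.1 * _]mulrC e oppr0.
Qed.

Lemma loc_equivf_sym : symmetric loc_equivf.
Proof. by move=> x y; apply/idP/idP; apply: loc_equivf_symW. Qed.

Lemma loc_equivf_trans : transitive loc_equivf.
Proof.
move=> [y [s' hs']] [x [s hs]] [z [s'' hs'']] /loc_equivfP[t tm /= e1].
move=> /loc_equivfP[t' t'm /= e2]; apply/loc_equivfP; exists (s' * t * t').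
  by rewrite !(maximal_complM hm).
rewrite /=.
have -> : (x * s'' - s * z) * (s' * t * t') =
    s'' * t' * ((x * s' - s * y) * t) + s * t * ((y * s'' - s' * z) * t').
  by ring.
by rewrite e1 e2 !mulr0 addr0.
Qed.

Canonical loc_equivf_equiv :=
  EquivRel loc_equivf loc_equivf_refl loc_equivf_sym loc_equivf_trans.

Definition localization := {eq_quot loc_equivf}.

HB.instance Definition _ : EqQuotient _ loc_equivf localization :=
  EqQuotient.on localization.
HB.instance Definition _ := Choice.on localization.

Definition loc_zero : localization := \pi_localization (0, loc_denom1).
Definition loc_one : localization := \pi_localization (1, loc_denom1).

Definition loc_addf (x y : pair) : pair :=
  (x.1 * val y.2 + y.1 * val x.2, loc_denomM x.2 y.2).
Definition loc_add := lift_op2 localization loc_addf.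

Definition loc_oppf (x : pair) : pair := (- x.1, x.2).
Definition loc_opp := lift_op1 localization loc_oppf.

Definition loc_mulf (x y : pair) : pair := (x.1 * y.1, loc_denomM x.2 y.2).
Definition loc_mul := lift_op2 localization loc_mulf.

Lemma loc_pair_ext (x y : pair) : x.1 = y.1 -> val x.2 = val y.2 -> x = y.
Proof. by case: x y => [a s] [b t] /= -> /val_inj ->. Qed.

Lemma loc_addfC x y : loc_addf x y = loc_addf y x.
Proof. by apply: loc_pair_ext => /=; [exact: addrC | exact: mulrC]. Qed.

Lemma loc_mulfC x y : loc_mulf x y = loc_mulf y x.
Proof. by apply: loc_pair_ext => /=; exact: mulrC. Qed.

Lemma loc_equivf_repr (x : pair) : loc_equivf (repr (\pi_localization x)) x.
Proof. by rewrite -eqmodE reprK. Qed.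

Lemma loc_addf_equivl (x x' y : pair) :
  loc_equivf x x' -> loc_equivf (loc_addf x y) (loc_addf x' y).
Proof.
case: x x' y => [x [s hs]] [x' [s' hs']] [y [u hu]] /loc_equivfP[t tm /= e].
apply/loc_equivfP; exists t => //=.
have -> : (x * u + y * s) * (s' * u) - s * u * (x' * u + y * s')
        = (x * s' - s * x') * (u * u).
  by ring.
by rewrite mulrAC e mul0r.
Qed.

Lemma loc_mulf_equivl (x x' y : pair) :
  loc_equivf x x' -> loc_equivf (loc_mulf x y) (loc_mulf x' y).
Proof.
case: x x' y => [x [s hs]] [x' [s' hs']] [y [u hu]] /loc_equivfP[t tm /= e].
apply/loc_equivfP; exists t => //=.
have -> : x * y * (s' * u) - s * u * (x' * y) = (x * s' - s * x') * (y * u).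
  by ring.
by rewrite mulrAC e mul0r.
Qed.

Lemma loc_pi_add : {morph \pi : x y / loc_addf x y >-> loc_add x y}.
Proof.
move=> x y; unlock loc_add; apply/eqmodP => /=; rewrite loc_equivf_sym.
apply: (@loc_equivf_trans (loc_addf x (repr (\pi_localization y)))).
  exact/loc_addf_equivl/loc_equivf_repr.
rewrite loc_addfC [loc_addf x y]loc_addfC.
by apply/loc_addf_equivl/loc_equivf_repr.
Qed.
Canonical loc_pi_add_morph := PiMorph2 loc_pi_add.

Lemma loc_pi_opp : {morph \pi : x / loc_oppf x >-> loc_opp x}.
Proof.
move=> x; unlock loc_opp; apply/eqmodP => /=; rewrite loc_equivf_sym.
have /loc_equivfP[t tm e] := loc_equivf_repr x.
apply/loc_equivfP; exists t => //=.
by rewrite mulNr mulrN -opprD mulNr e oppr0.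
Qed.
Canonical loc_pi_opp_morph := PiMorph1 loc_pi_opp.

Lemma loc_pi_mul : {morph \pi : x y / loc_mulf x y >-> loc_mul x y}.
Proof.
move=> x y; unlock loc_mul; apply/eqmodP => /=; rewrite loc_equivf_sym.
apply: (@loc_equivf_trans (loc_mulf x (repr (\pi_localization y)))).
  exact/loc_mulf_equivl/loc_equivf_repr.
rewrite loc_mulfC [loc_mulf x y]loc_mulfC.
by apply/loc_mulf_equivl/loc_equivf_repr.
Qed.
Canonical loc_pi_mul_morph := PiMorph2 loc_pi_mul.

Lemma loc_addA : associative loc_add.
Proof.
elim/quotW=> x; elim/quotW=> y; elim/quotW=> z; rewrite !piE.
by congr (\pi _); apply: loc_pair_ext => /=; ring.
Qed.

Lemma loc_addC : commutative loc_add.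
Proof. by elim/quotW=> x; elim/quotW=> y; rewrite !piE loc_addfC. Qed.

Lemma loc_add0 : left_id loc_zero loc_add.
Proof.
elim/quotW=> x; rewrite /loc_zero !piE /loc_addf /= mul0r add0r mulr1.
by congr (\pi _); apply: loc_pair_ext; rewrite //= mul1r.
Qed.

Lemma loc_addN : left_inverse loc_zero loc_opp loc_add.
Proof.
elim/quotW=> x; rewrite /loc_zero !piE; apply/eqmodP/loc_equivfP.
exists 1; first exact: maximal_compl1 hm.
by rewrite /= mulr0 subr0 mulNr addNr !mul0r.
Qed.

HB.instance Definition _ :=
  GRing.isZmodule.Build localization loc_addA loc_addC loc_add0 loc_addN.

Lemma loc_mulA : associative loc_mul.
Proof.
elim/quotW=> x; elim/quotW=> y; elim/quotW=> z; rewrite !piE.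
by congr (\pi _); apply: loc_pair_ext; rewrite /= mulrA.
Qed.

Lemma loc_mulC : commutative loc_mul.
Proof. by elim/quotW=> x; elim/quotW=> y; rewrite !piE loc_mulfC. Qed.

Lemma loc_mul1 : left_id loc_one loc_mul.
Proof.
elim/quotW=> x; rewrite /loc_one !piE /loc_mulf /= mul1r.
by congr (\pi _); apply: loc_pair_ext; rewrite //= mul1r.
Qed.

Lemma loc_mulDl : left_distributive loc_mul loc_add.
Proof.
elim/quotW=> x; elim/quotW=> y; elim/quotW=> z; rewrite !piE.
apply/eqmodP/loc_equivfP; exists 1; first exact: maximal_compl1 hm.
case: x y z => [x [s hs]] [y [t ht]] [z [u hu]] /=.
by ring.
Qed.

Lemma loc_one_neq0 : loc_one != loc_zero.
Proof.
apply/eqP => /eqmodP/loc_equivfP[t tm] /=.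
by rewrite !mul1r subr0 mul1r => t0; move: tm; rewrite t0 (maximal0 hm).
Qed.

HB.instance Definition _ :=
  GRing.Zmodule_isComNzRing.Build localization
    loc_mulA loc_mulC loc_mul1 loc_mulDl loc_one_neq0.

(* r / s, with the dummy value 0 when s is not an admissible denominator *)
Definition loc_frac (r s : R) : localization :=
  if insub s is Some d then \pi_localization (r, d) else loc_zero.

End Localization.

(* A fraction r / s is coded by a list starting with codes of r and s. *)
Definition frac_numbering (R : comNzRingType) (m : {pred R})
    (hm : maximal_ideal m) (nu : nat -> R) : nat -> localization hm :=
  fun c => let l := CodeSeq.decode c in
    loc_frac hm (nu (nth 0%N l 0)) (nu (nth 0%N l 1)).

(* Main.v *)
From HB Require Import structures.
Require Import Defs.
From mathcomp Require Import all_boot all_order all_algebra.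
From mathcomp Require Import ring.
From mathcomp Require Import boolp.

(** Write S for the complement of m.  Every question about a linear system
    over S^-1 R is turned into a question about one linear system over R.

    A matrix over S^-1 R becomes a matrix over R after multiplication by a
    common denominator, which is a unit of S^-1 R.  Since localization is
    exact, generators of the syzygies of the cleared matrix over R generate
    the syzygies over S^-1 R (loc_syzygies).

    For a row b and a matrix A over R, b lies in the row space of A over
    S^-1 R iff t b lies in the row space of A over R for some t in S
    (loc_row_sub).  No search for t is needed: as m is maximal, 1 = r t + c
    with c in m, so that b lies in rowspace(A) + m b; conversely, if
    b = y A + c b with c in m, then t = 1 - c is in S.  This is the argument
    of Nakayama's lemma.  As m is generated by g_1, ..., g_k, the condition
    says that b lies in the row space over R of A with the k rows g_i b
    appended (loc_row_sub_nakayama), which R decides effectively; a solution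
    over R yields both the denominator t and the numerators of a solution
    over S^-1 R (nakayama_solution).

    The same test decides everything else.  An element s is outside m iff 1
    lies in the row space of (s) over S^-1 R, which allows the denominators
    coming from arbitrary codes to be validated; and r is 0 in S^-1 R iff the
    row (r) lies in the row space of the matrix with no rows, which decides
    equality of fractions.  Systems on the right are transposed systems on
    the left because the ring is commutative (right_computable_tr).

    It remains to see that the functions on codes so obtained are recursive.
    The point is that a recursive function reads finitely many of its
    arguments (recursive_support); it may therefore be applied to any list
    whose entries are recursive functions of the environment
    (recursive_subst), and expressions built with variables, conditionals and
    bounded loops are recognized as recursive by a syntax-directed proof
    search. *)

Set Implicit Arguments.
Unset Strict Implicit.
Unset Printing Implicit Defensive.

Import GRing.Theory.

(** * Closure properties of recursive functions *)
Definition agree (k : nat) (s t : seq nat) : Prop :=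
  forall i, i < k -> nth 0 s i = nth 0 t i.

Lemma agree_cons k x s t : agree k s t -> agree k.+1 (x :: s) (x :: t).
Proof. by move=> st [|i] // /st. Qed.

Lemma agree_behead k s t : agree k.+1 s t -> agree k (behead s) (behead t).
Proof. by move=> st i ik; rewrite !nth_behead st. Qed.

Lemma agree_leq j k s t : j <= k -> agree k s t -> agree j s t.
Proof. by move=> jk st i ij; apply: st; apply: leq_trans jk. Qed.

(** Arguments are passed as lists of arbitrary length, but each of the schemes
    generating the recursive functions looks at a bounded part of the list. *)
Lemma recursive_support f :
  recursive f -> exists k, forall s t, agree k s t -> f s = f t.
Proof.
elim=> {f} [||i|f gs _ [k fk] _ IH|f g _ [k fk] _ [l gl]|f ex _ [k fk]
  |f f' ff' _ [k fk]].
- by exists 0.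
- by exists 1 => s t ->.
- by exists i.+1 => s t ->.
- suff [l gl] : exists l, forall s t, agree l s t ->
      [seq g s | g <- gs] = [seq g t | g <- gs].
    by exists l => s t /gl ->.
  elim: gs IH => [|g gs IHgs] IH; first by exists 0.
  have [l1 gl1] := IH g (or_introl erefl).
  have [h hin|l2 gl2] := IHgs; first by apply: IH; right.
  exists (maxn l1 l2) => s t st /=; congr (_ :: _).
    by apply: gl1; apply: agree_leq st; apply: leq_maxl.
  by apply: gl2; apply: agree_leq st; apply: leq_maxr.
- exists (maxn k l).+1 => s t st; rewrite (st 0) //.
  have st' := agree_behead st.
  elim: (nth 0 t 0) => [|n IHn] /=.
    by apply: fk; apply: agree_leq st'; apply: leq_maxl.
  rewrite IHn; apply: gl; apply: (@agree_leq _ (maxn k l).+2).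
    by rewrite (leq_trans (leq_maxr k l)) // -addn2 leq_addr.
  by do 2!apply: agree_cons.
- exists k => s t st; apply: eq_ex_minn => n; congr (_ == 0).
  by apply: fk; apply: agree_leq (agree_cons n st).
- by exists k => s t /fk; rewrite !ff'.
Qed.

(** Composition only substitutes finitely many functions, while e may change
    infinitely many entries of the environment, for instance shift all of
    them; a finite support of f reduces one to the other. *)
Lemma recursive_subst f (e : seq nat -> seq nat) :
  recursive f -> (forall i, recursive (fun s => nth 0 (e s) i)) ->
  recursive (fun s => f (e s)).
Proof.
move=> fr er; have [k fk] := recursive_support fr.
pose gs := [seq (fun s => nth 0 (e s) i) | i <- iota 0 k].
apply: (@rec_ext (fun s => f [seq g s | g <- gs])) => [s|].
  apply: fk => i ik; rewrite -map_comp (nth_map 0) ?size_iota //=.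
  by rewrite nth_iota.
apply: rec_comp fr _ => h; rewrite /gs; elim: (iota 0 k) => //= i l IH.
by case=> [<-|/IH].
Qed.

Lemma recursive_drop f n : recursive f -> recursive (fun s => f (drop n s)).
Proof.
move=> fr; apply: (recursive_subst fr) => i.
by apply: (rec_ext _ (rec_proj (n + i))) => s; rewrite nth_drop.
Qed.

Lemma recursive_const n : recursive (fun => n).
Proof.
elim: n => [|n IH]; first exact: rec_zero.
by apply: (@recursive_subst _ (fun=> [:: n]) rec_succ) => -[|[|i]] //=;
  exact: rec_zero.
Qed.

Definition recursive3 (f : nat -> nat -> nat -> nat) : Prop :=
  recursive (fun s => f (nth 0 s 0) (nth 0 s 1) (nth 0 s 2)).

Definition recursive_test (P : seq nat -> bool) : Prop :=
  recursive (fun s => P s).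

Lemma recursive_app1 f a : recursive1 f -> recursive a ->
  recursive (fun s => f (a s)).
Proof.
move=> fr ar; apply: (@recursive_subst _ (fun s => [:: a s]) fr) => -[|i] //=.
by rewrite nth_nil; exact: rec_zero.
Qed.

Lemma recursive_app2 f a b : recursive2 f -> recursive a -> recursive b ->
  recursive (fun s => f (a s) (b s)).
Proof.
move=> fr ar br.
apply: (@recursive_subst _ (fun s => [:: a s; b s]) fr) => -[|[|i]] //=.
by rewrite nth_nil; exact: rec_zero.
Qed.

Lemma recursive_app3 f a b c :
  recursive3 f -> recursive a -> recursive b -> recursive c ->
  recursive (fun s => f (a s) (b s) (c s)).
Proof.
move=> fr ar br cr.
apply: (@recursive_subst _ (fun s => [:: a s; b s; c s]) fr) => -[|[|[|i]]] //=.
by rewrite nth_nil; exact: rec_zero.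
Qed.

(** The body of a loop is an expression in a longer environment: its first two
    entries are the counter and the value computed so far, and the outer
    environment follows. *)
Lemma recursive_iteri n a (G : nat -> nat -> seq nat -> nat) :
  recursive n -> recursive a ->
  recursive (fun t => G (nth 0 t 0) (nth 0 t 1) (drop 2 t)) ->
  recursive (fun s => iteri (n s) (fun i r => G i r s) (a s)).
Proof.
move=> nr ar Gr.
apply: (@rec_ext (fun s => (fun t => iteri (nth 0 t 0)
    (fun i r => G i r (drop 0 (behead t))) (a (behead t))) (n s :: s))).
  by move=> s /=; rewrite drop0.
apply: recursive_subst (rec_prim ar Gr) _ => -[|i] //=; exact: rec_proj.
Qed.

Lemma recursive_if (P : seq nat -> bool) a b :
  recursive_test P -> recursive a -> recursive b ->
  recursive (fun s => if P s then a s else b s).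
Proof.
move=> Pr ar br.
apply: (@rec_ext (fun s => iteri (P s) (fun _ _ => a s) (b s))).
  by move=> s; case: (P s).
by apply: recursive_iteri => //; apply: recursive_drop.
Qed.

Lemma recursive_nth_drop e m i :
  recursive (fun s => nth 0 (e s) (m + i)) ->
  recursive (fun s => nth 0 (drop m (e s)) i).
Proof. by apply: rec_ext => s; rewrite nth_drop. Qed.

(** Proofs that an expression is recursive follow its syntax: loops and
    conditionals are handled by their own lemmas, and any other application
    by the recursiveness of its head. *)
Create HintDb recfun.

Ltac recfun :=
  rewrite ?/recursive1 ?/recursive2 ?/recursive3;
  solve [auto 100 with recfun nocore].

#[local] Hint Resolve rec_proj recursive_const recursive_iteri recursive_if
  recursive_nth_drop : recfun.

(** The head must be found recursive before the arguments are examined, so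
    that a partial application such as logn 2 is tried as a head when logn
    itself has no recursiveness lemma. *)
#[local] Hint Extern 3 (recursive _) =>
  match goal with
  | |- recursive (fun s => ?f (@?a s) (@?b s) (@?c s)) =>
      apply: (@recursive_app3 f a b c); [solve [auto with recfun nocore] | ..]
  | |- recursive (fun s => ?f (@?a s) (@?b s)) =>
      apply: (@recursive_app2 f a b); [solve [auto with recfun nocore] | ..]
  | |- recursive (fun s => ?f (@?a s)) =>
      apply: (@recursive_app1 f a); [solve [auto with recfun nocore] | ..]
  end : recfun.

Lemma recursive_succ : recursive1 succn.
Proof. exact: rec_succ. Qed.
#[local] Hint Resolve recursive_succ : recfun.

Lemma recursive_addn : recursive2 addn.
Proof.
apply: (@rec_ext (fun s => iteri (nth 0 s 0) (fun _ r => r.+1) (nth 0 s 1))).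
  by move=> s; elim: (nth 0 s 0) => //= n ->.
by recfun.
Qed.
#[local] Hint Resolve recursive_addn : recfun.

Lemma recursive_muln : recursive2 muln.
Proof.
apply: (@rec_ext (fun s => iteri (nth 0 s 0) (fun _ r => nth 0 s 1 + r) 0)).
  by move=> s; elim: (nth 0 s 0) => //= n ->.
by recfun.
Qed.
#[local] Hint Resolve recursive_muln : recfun.

Lemma recursive_expn : recursive2 expn.
Proof.
apply: (@rec_ext (fun s => iteri (nth 0 s 1) (fun _ r => nth 0 s 0 * r) 1)).
  by move=> s; elim: (nth 0 s 1) => //= n ->; rewrite expnS.
by recfun.
Qed.
#[local] Hint Resolve recursive_expn : recfun.

Lemma recursive_pred : recursive1 predn.
Proof.
apply: (@rec_ext (fun s => iteri (nth 0 s 0) (fun i _ => i) 0)).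
  by move=> s; case: (nth 0 s 0).
by recfun.
Qed.
#[local] Hint Resolve recursive_pred : recfun.

Lemma recursive_subn : recursive2 subn.
Proof.
apply: (@rec_ext (fun s => iteri (nth 0 s 1) (fun _ r => r.-1) (nth 0 s 0))).
  by move=> s; elim: (nth 0 s 1) => [|n IH]; rewrite ?subn0 //= IH subnS.
by recfun.
Qed.
#[local] Hint Resolve recursive_subn : recfun.

Lemma recursive_eqn a b : recursive a -> recursive b ->
  recursive_test (fun s => a s == b s).
Proof.
move=> ar br; apply: (@rec_ext (fun s => 1 - ((a s - b s) + (b s - a s)))).
  by move=> s; rewrite eqn_leq -!subn_eq0 -addn_eq0; case: (_ + _).
by recfun.
Qed.

Lemma recursive_leq a b : recursive a -> recursive b ->
  recursive_test (fun s => a s <= b s).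
Proof.
move=> ar br; apply: (@rec_ext (fun s => 1 - (a s - b s))).
  by move=> s; rewrite -subn_eq0; case: (a s - b s).
by recfun.
Qed.

Lemma recursive_andb P Q : recursive_test P -> recursive_test Q ->
  recursive_test (fun s => P s && Q s).
Proof.
rewrite /recursive_test => Pr Qr; apply: (@rec_ext (fun s => P s * Q s)).
  by move=> s; case: (P s); case: (Q s).
by recfun.
Qed.

Lemma recursive_negb P : recursive_test P -> recursive_test (fun s => ~~ P s).
Proof.
rewrite /recursive_test => Pr; apply: (@rec_ext (fun s => 1 - P s)).
  by move=> s; case: (P s).
by recfun.
Qed.

#[local] Hint Resolve recursive_eqn recursive_leq recursive_andb
  recursive_negb : recfun.

(** The value is found by unbounded search, so a function only needs a
    decidable graph; this avoids programming quotients and valuations. *)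
Lemma recursive_graph F (P : nat -> seq nat -> bool) :
  recursive_test (fun t => P (nth 0 t 0) (drop 1 t)) ->
  (forall s n, P n s = (n == F s)) -> recursive F.
Proof.
rewrite /recursive_test => Pr PF.
pose f t : nat := 1 - P (nth 0 t 0) (drop 1 t).
have fE n s : (f (n :: s) == 0) = (n == F s).
  by rewrite /f /= drop0 PF; case: (n == _).
have ex s : exists n, f (n :: s) == 0 by exists (F s); rewrite fE.
apply: (@rec_ext (fun s => ex_minn (ex s))).
  by move=> s; case: ex_minnP => n; rewrite fE => /eqP.
by apply: rec_min; rewrite /f; recfun.
Qed.

(** The last conjunct pins the quotient by 0 to its conventional value 0. *)
Lemma recursive_divn : recursive2 divn.
Proof.
apply: (@recursive_graph _ (fun n s => (n * nth 0 s 1 <= nth 0 s 0) &&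
  ~~ ((n.+1 * nth 0 s 1 <= nth 0 s 0) && ~~ ((nth 0 s 1 == 0) && (n == 0))))).
  by recfun.
move=> s n; case: (posnP (nth 0 s 1)) => [->|d0].
  by rewrite !muln0 divn0 /= negbK.
by rewrite /= andbT -!leq_divRL // -ltnNge ltnS eqn_leq andbC.
Qed.
#[local] Hint Resolve recursive_divn : recfun.

Lemma recursive_modn : recursive2 modn.
Proof.
apply: (@rec_ext (fun s => nth 0 s 0 - nth 0 s 0 %/ nth 0 s 1 * nth 0 s 1)).
  by move=> s; rewrite {1}(divn_eq (nth 0 s 0) (nth 0 s 1)) addKn.
by recfun.
Qed.
#[local] Hint Resolve recursive_modn : recfun.

Lemma recursive_dvdn a b : recursive a -> recursive b ->
  recursive_test (fun s => a s %| b s).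
Proof. by move=> ar br; rewrite /dvdn; recfun. Qed.
#[local] Hint Resolve recursive_dvdn : recfun.

Lemma recursive_logn2 : recursive1 (logn 2).
Proof.
apply: (@recursive_graph _ (fun n s => (2 ^ n %| nth 0 s 0) &&
  ~~ ((2 ^ n.+1 %| nth 0 s 0) && ~~ ((nth 0 s 0 == 0) && (n == 0))))).
  by recfun.
move=> s n; case: (posnP (nth 0 s 0)) => [->|c0].
  by rewrite !dvdn0 logn0 /= negbK.
by rewrite /= andbT !pfactor_dvdn // -ltnNge ltnS eqn_leq andbC.
Qed.
#[local] Hint Resolve recursive_logn2 : recfun.

(** * Coded lists and matrices *)

Definition entry (c i : nat) : nat := nth 0 (CodeSeq.decode c) i.

Lemma entry_code l i : entry (CodeSeq.code l) i = nth 0 l i.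
Proof. by rewrite /entry CodeSeq.codeK. Qed.

Lemma logn2_cons n m : logn 2 (2 ^ n * m.*2.+1) = n.
Proof.
rewrite lognM ?expn_gt0 // pfactorK // lognE /= dvdn2 /= odd_double.
by rewrite addn0.
Qed.

(** The code of n :: l is 2 ^ n * (2 * code l + 1): the head is a 2-adic
    valuation and the tail is what remains of the binary expansion. *)
Lemma recursive_entry : recursive2 entry.
Proof.
pose tail c := c %/ 2 ^ (logn 2 c).+1.
apply: (@rec_ext (fun s =>
  logn 2 (iteri (nth 0 s 1) (fun _ r => tail r) (nth 0 s 0)))).
  move=> s; rewrite /entry -{1}(CodeSeq.decodeK (nth 0 s 0)).
  move: (CodeSeq.decode _) => l.
  have -> : iteri (nth 0 s 1) (fun=> tail) (CodeSeq.code l) =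
            CodeSeq.code (drop (nth 0 s 1) l).
    elim: (nth 0 s 1) => [|n IH] /=; first by rewrite drop0.
    rewrite IH -add1n -drop_drop; case: (drop n l) => [|x t] /=.
      by rewrite /tail div0n.
    rewrite drop0 /tail logn2_cons expnSr divnMl ?expn_gt0 //.
    by rewrite -muln2 -addn1 divnMDl // addn0.
  rewrite -[in RHS](addn0 (nth 0 s 1)) -nth_drop.
  by case: (drop _ l) => [|x t] //=; rewrite logn2_cons.
rewrite /tail; recfun.
Qed.
#[local] Hint Resolve recursive_entry : recfun.

Lemma recursive_cons a c : recursive a -> recursive c ->
  recursive (fun s => 2 ^ a s * (c s).*2.+1).
Proof.
move=> ar cr; apply: (@rec_ext (fun s => 2 ^ a s * (2 * c s).+1)).
  by move=> s; rewrite mul2n.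
by recfun.
Qed.
#[local] Hint Resolve recursive_cons : recfun.

(** Instantiates the loop variable of F, its first argument, by a value that
    may depend on entries of the environment that F does not see. *)
Lemma recursive_bind n (F : nat -> seq nat -> nat) a :
  recursive (fun t => F (nth 0 t 0) (drop 1 t)) -> recursive a ->
  recursive (fun s => F (a s) (drop n s)).
Proof.
move=> Fr ar; have := @recursive_subst _ (fun s => a s :: drop n s) Fr.
rewrite /= => H.
apply: (@rec_ext (fun s => F (a s) (drop 0 (drop n s)))).
  by move=> s; rewrite drop0.
by apply: H => -[|i] //=; recfun.
Qed.

(** A list is built from its last entry, hence the reversed index. *)
Lemma recursive_code_mkseq n (F : nat -> seq nat -> nat) :
  recursive n -> recursive (fun t => F (nth 0 t 0) (drop 1 t)) ->
  recursive (fun s => CodeSeq.code (mkseq (fun i => F i s) (n s))).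
Proof.
move=> nr Fr.
apply: (@rec_ext (fun s => iteri (n s)
    (fun i r => 2 ^ F (n s - i.+1) s * r.*2.+1) 0)).
  move=> s; rewrite /mkseq.
  suff H k : k <= n s -> iteri k (fun i r => 2 ^ F (n s - i.+1) s * r.*2.+1) 0
      = CodeSeq.code [seq F i s | i <- iota (n s - k) k].
    by rewrite H // subnn.
  elim: k => //= k IH kn; rewrite IH ?(ltnW kn) //.
  by rewrite subnSK.
apply: recursive_iteri => //; first by recfun.
apply: recursive_cons; last by recfun.
apply: (@recursive_bind 2 F) => //.
have nr' : recursive (fun t => n (drop 2 t)) by exact: recursive_drop.
by recfun.
Qed.

Lemma recursive_bind2 n (F : nat -> nat -> seq nat -> nat) a b :
  recursive (fun t => F (nth 0 t 0) (nth 0 t 1) (drop 2 t)) ->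
  recursive a -> recursive b ->
  recursive (fun s => F (a s) (b s) (drop n s)).
Proof.
move=> Fr ar br.
have := @recursive_subst _ (fun s => [:: a s, b s & drop n s]) Fr.
rewrite /= => H.
apply: (@rec_ext (fun s => F (a s) (b s) (drop 0 (drop n s)))).
  by move=> s; rewrite drop0.
by apply: H => -[|[|i]] //=; recfun.
Qed.

Lemma recursive_code2 a b : recursive a -> recursive b ->
  recursive (fun s => CodeSeq.code [:: a s; b s]).
Proof.
move=> ar br; apply: recursive_cons ar _; apply: recursive_cons br _; recfun.
Qed.

Definition mxcode (p q : nat) (F : nat -> nat -> nat) : nat :=
  CodeSeq.code [:: p, q & mkseq (fun k => F (k %/ q) (k %% q)) (p * q)].

Lemma recursive_mxcode p q (F : nat -> nat -> seq nat -> nat) :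
  recursive p -> recursive q ->
  recursive (fun t => F (nth 0 t 0) (nth 0 t 1) (drop 2 t)) ->
  recursive (fun s => mxcode (p s) (q s) (fun i j => F i j s)).
Proof.
move=> pr qr Fr; apply: (recursive_cons pr); apply: (recursive_cons qr).
apply: (recursive_code_mkseq
  (F := fun k s => F (k %/ q s) (k %% q s) s)); first by recfun.
have qr' : recursive (fun t => q (drop 1 t)) by exact: recursive_drop.
by apply: recursive_bind2 => //; recfun.
Qed.

Definition fold_upto (op : nat -> nat -> nat) (z n : nat) (F : nat -> nat) :=
  iteri n (fun i r => op r (F i)) z.

Lemma recursive_fold_upto op z n (F : nat -> seq nat -> nat) :
  recursive2 op -> recursive n ->
  recursive (fun t => F (nth 0 t 0) (drop 1 t)) ->
  recursive (fun s => fold_upto op z (n s) (fun i => F i s)).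
Proof.
move=> opr nr Fr; apply: recursive_iteri => //; first by recfun.
have Fr' : recursive (fun t => F (nth 0 t 0) (drop 2 t)).
  by apply: recursive_bind => //; recfun.
by recfun.
Qed.

#[local] Hint Resolve recursive_code2 recursive_mxcode recursive_fold_upto
  : recfun.

Definition mxrows (c : nat) := entry c 0.
Definition mxcols (c : nat) := entry c 1.
Definition mxentry (c i j : nat) := entry c (i * mxcols c + j).+2.

Lemma recursive_mxrows : recursive1 mxrows.
Proof. by rewrite /mxrows; recfun. Qed.

Lemma recursive_mxcols : recursive1 mxcols.
Proof. by rewrite /mxcols; recfun. Qed.
#[local] Hint Resolve recursive_mxrows recursive_mxcols : recfun.

Lemma recursive_mxentry : recursive3 mxentry.
Proof. by rewrite /mxentry; recfun. Qed.
#[local] Hint Resolve recursive_mxentry : recfun.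

Section CodedMatrices.

Variables (R : pzRingType) (nu : nat -> R).

Lemma mkseq_allpairs (p q : nat) (F : nat -> nat -> nat) :
  [seq F i j | i <- iota 0 p, j <- iota 0 q] =
  mkseq (fun k => F (k %/ q) (k %% q)) (p * q).
Proof.
elim: p => [|p IH] //; rewrite -addn1 iotaD allpairs_cat IH /= cats0.
rewrite mulnDl mul1n /mkseq iotaD map_cat; congr (_ ++ _).
rewrite -[in RHS](addn0 (0 + p * q)) add0n iotaDl -map_comp.
apply/eq_in_map => j; rewrite mem_iota /= add0n => jq.
have q0 : 0 < q by apply: leq_ltn_trans jq.
by rewrite divnMDl // divn_small // addn0 modnMDl modn_small.
Qed.

Lemma seq_mxE p q (E : 'I_p -> 'I_q -> nat) (F : nat -> nat -> nat) :
  (forall i j, E i j = F i j) ->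
  [seq E i j | i <- enum 'I_p, j <- enum 'I_q] =
  mkseq (fun k => F (k %/ q) (k %% q)) (p * q).
Proof.
move=> EF; rewrite -mkseq_allpairs -!val_enum_ord allpairs_mapl allpairs_mapr.
by apply: eq_allpairs => i j; rewrite EF.
Qed.

Lemma codes_mxcode p q (A : 'M[R]_(p, q)) (F : nat -> nat -> nat) :
  (forall (i : 'I_p) (j : 'I_q), nu (F i j) = A i j) ->
  codes_mx nu (mxcode p q F) A.
Proof.
move=> FA; exists (\matrix_(i, j) F i j)%R; split.
  by apply/matrixP => i j; rewrite !mxE FA.
by congr CodeSeq.code; rewrite (@seq_mxE _ _ _ F) // => i j; rewrite mxE.
Qed.

Lemma codes_mxP c p q (A : 'M[R]_(p, q)) : codes_mx nu c A ->
  [/\ mxrows c = p, mxcols c = q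
    & forall (i : 'I_p) (j : 'I_q), nu (mxentry c i j) = A i j].
Proof.
case=> E [-> ->]; rewrite /mxrows /mxentry /mxcols !entry_code; split=> // i j.
have q0 : 0 < q by apply: leq_ltn_trans (ltn_ord j).
(* E is extended by 0 outside its bounds, to apply seq_mxE *)
pose F i' j' := if insub i' is Some i'' then
   if insub j' is Some j'' then E i'' j'' else 0 else 0.
rewrite entry_code (@seq_mxE _ _ _ F); last first.
  by move=> i' j'; rewrite /F !valK.
rewrite /= nth_mkseq; last first.
  apply: (@leq_trans (i * q + q)); first by rewrite ltn_add2l.
  by rewrite -mulSnr leq_mul2r ltn_ord orbT.
rewrite divnMDl // divn_small // addn0 modnMDl modn_small // /F !valK.
by rewrite mxE.
Qed.

End CodedMatrices.

(** * Linear algebra over the localization *)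

Local Open Scope ring_scope.
Local Open Scope quotient_scope.

Section Fractions.

Variables (R : comNzRingType) (m : {pred R}) (hm : maximal_ideal m).

Local Notation L := (localization hm).

Lemma loc_fracE r s (sm : s \notin m) :
  loc_frac hm r s = \pi_L (r, exist _ s sm).
Proof. by rewrite /loc_frac insubT. Qed.

Lemma loc_fracP (x : L) : exists r s, s \notin m /\ x = loc_frac hm r s.
Proof.
elim/quotW: x => -[r [s sm]]; exists r, s; split=> //; exact/esym/loc_fracE.
Qed.

Lemma loc_frac_eq r s r' s' : s \notin m -> s' \notin m ->
  loc_frac hm r s = loc_frac hm r' s' <->
  exists2 t, t \notin m & (r * s' - s * r') * t = 0.
Proof.
move=> sm sm'; rewrite (loc_fracE r sm) (loc_fracE r' sm'); split.
  by move/eqmodP/loc_equivfP.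
by move=> H; apply/eqmodP/loc_equivfP.
Qed.

Lemma loc_fracD r s r' s' : s \notin m -> s' \notin m ->
  loc_frac hm r s + loc_frac hm r' s' = loc_frac hm (r * s' + r' * s) (s * s').
Proof.
move=> sm sm'; rewrite (loc_fracE r sm) (loc_fracE r' sm').
rewrite (loc_fracE _ (maximal_complM hm sm sm')) [LHS]piE.
by congr (\pi _); apply: loc_pair_ext.
Qed.

Lemma loc_fracN r s : s \notin m -> - loc_frac hm r s = loc_frac hm (- r) s.
Proof. by move=> sm; rewrite !(loc_fracE _ sm) [LHS]piE. Qed.

Lemma loc_fracM r s r' s' : s \notin m -> s' \notin m ->
  loc_frac hm r s * loc_frac hm r' s' = loc_frac hm (r * r') (s * s').
Proof.
move=> sm sm'; rewrite (loc_fracE r sm) (loc_fracE r' sm').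
rewrite (loc_fracE _ (maximal_complM hm sm sm')) [LHS]piE.
by congr (\pi _); apply: loc_pair_ext.
Qed.

Definition loc_inj (r : R) : L := loc_frac hm r 1.

Let m1 : 1 \notin m := maximal_compl1 hm.

Lemma loc_inj0 : loc_inj 0 = 0.
Proof.
rewrite /loc_inj (loc_fracE _ m1); congr (\pi _); exact: loc_pair_ext.
Qed.

Lemma loc_inj1 : loc_inj 1 = 1.
Proof.
rewrite /loc_inj (loc_fracE _ m1); congr (\pi _); exact: loc_pair_ext.
Qed.

Lemma loc_injB : {morph loc_inj : r s / r - s}.
Proof.
by move=> r s; rewrite /loc_inj loc_fracN // loc_fracD // !mulr1.
Qed.

Lemma loc_inj_monoid : monoid_morphism loc_inj.
Proof.
by split=> [|r s]; [exact: loc_inj1|rewrite /loc_inj loc_fracM // mulr1].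
Qed.

HB.instance Definition _ := GRing.isZmodMorphism.Build R L loc_inj loc_injB.
HB.instance Definition _ :=
  GRing.isMonoidMorphism.Build R L loc_inj loc_inj_monoid.

Lemma loc_inj_frac r s : s \notin m -> loc_inj s * loc_frac hm r s = loc_inj r.
Proof.
move=> sm; rewrite /loc_inj loc_fracM // mul1r loc_frac_eq //.
by exists 1 => //; rewrite !mulr1 subrr.
Qed.

Lemma loc_inj_unit s : s \notin m -> loc_frac hm 1 s * loc_inj s = 1.
Proof. by move=> sm; rewrite mulrC loc_inj_frac // loc_inj1. Qed.

Lemma loc_inj_regular s : s \notin m -> GRing.lreg (loc_inj s).
Proof.
move=> sm x y /(congr1 ( *%R (loc_frac hm 1 s))).
by rewrite !mulrA loc_inj_unit // !mul1r.
Qed.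

Lemma loc_inj_eq0 r : loc_inj r = 0 <-> exists2 t, t \notin m & r * t = 0.
Proof.
by rewrite -loc_inj0 /loc_inj loc_frac_eq // mulr1 mulr0 subr0.
Qed.

Lemma loc_frac_eq_inj r s r' s' : s \notin m -> s' \notin m ->
  loc_frac hm r s = loc_frac hm r' s' <-> loc_inj (r * s' - s * r') = 0.
Proof. by move=> sm sm'; rewrite loc_frac_eq // loc_inj_eq0. Qed.

Lemma loc_compl_prod (I : finType) (s : I -> R) :
  (forall i, s i \notin m) -> \prod_i s i \notin m.
Proof.
move=> sm; elim/big_ind: _ => // u v; exact: maximal_complM.
Qed.

(** The numerator of a cleared entry is a single product over the same index
    set as the common denominator, which makes it a bounded loop on codes. *)
Lemma loc_common_denominator (I : finType) (r s : I -> R) (k : I) :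
  (forall i, s i \notin m) ->
  loc_inj (\prod_i s i) * loc_frac hm (r k) (s k) =
  loc_inj (\prod_i if i == k then r i else s i).
Proof.
move=> sm; rewrite (bigD1 k) //= [in RHS](bigD1 k) //= eqxx.
rewrite !rmorphM /= mulrAC loc_inj_frac //; congr (_ * loc_inj _).
by apply: eq_bigr => i /negPf ->.
Qed.

Lemma loc_clear_row n (x : 'rV[L]_n) : exists2 s, s \notin m &
  exists x' : 'rV[R]_n, loc_inj s *: x = map_mx loc_inj x'.
Proof.
have [f fP] := choice (fun j => loc_fracP (x 0 j)).
have [g gP] := choice fP.
exists (\prod_j g j); first by apply: loc_compl_prod => j; case: (gP j).
exists (\row_j \prod_i if i == j then f i else g i).
apply/rowP => j; rewrite !mxE; have [_ ->] := gP j.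
by apply: loc_common_denominator => i; case: (gP i).
Qed.

(** Each entry is killed by some element outside m; their product kills all of
    them, and is outside m because m is prime. *)
Lemma loc_kernel_row n (x : 'rV[R]_n) :
  map_mx loc_inj x = 0 -> exists2 t, t \notin m & t *: x = 0.
Proof.
move=> x0; have /choice[t tP] j : exists t, t \notin m /\ x 0 j * t = 0.
  have /loc_inj_eq0[t tm e] : loc_inj (x 0 j) = 0.
    by move/rowP/(_ j): x0; rewrite !mxE.
  by exists t.
exists (\prod_j t j); first by apply: loc_compl_prod => j; case: (tP j).
apply/rowP => j; rewrite !mxE (bigD1 j) //= mulrAC [_ * x _ _]mulrC.
by have [_ ->] := tP j; rewrite mul0r.
Qed.

Lemma loc_row_sub (p q : nat) (A : 'M[R]_(p, q)) (b : 'rV[R]_q) :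
  (exists x : 'rV[L]_p, map_mx loc_inj b = x *m map_mx loc_inj A) <->
  (exists2 t, t \notin m & exists y : 'rV[R]_p, t *: b = y *m A).
Proof.
split=> [[x bx]|[t tm [y e]]].
  have [s sm [x' xx']] := loc_clear_row x.
  have [|t tm e] := @loc_kernel_row _ (s *: b - x' *m A).
    by rewrite map_mxB map_mxZ map_mxM /= -xx' bx scalemxAl subrr.
  exists (t * s); first exact: maximal_complM.
  exists (t *: x'); apply/eqP.
  by rewrite -scalerA -scalemxAl -subr_eq0 -scalerBr e.
exists (loc_frac hm 1 t *: map_mx loc_inj y).
rewrite -scalemxAl -map_mxM -e map_mxZ scalerA /= loc_inj_unit //.
by rewrite scale1r.
Qed.

(** Exactness of localization: a syzygy over the localization, multiplied by a
    suitable element outside m, is a syzygy of A' over R. *)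
Lemma loc_syzygies (p q n : nat) (A : 'M[L]_(p, q)) (s : R)
    (A' : 'M[R]_(p, q)) (X : 'M[R]_(n, p)) :
  s \notin m -> loc_inj s *: A = map_mx loc_inj A' ->
  left_syzygies_generators A' X ->
  left_syzygies_generators A (map_mx loc_inj X).
Proof.
move=> sm AA' XP x; split=> [xA|[y ->]].
  have [u um [x' xx']] := loc_clear_row x.
  have [|t tm e] := @loc_kernel_row _ (x' *m A').
    by rewrite map_mxM /= -xx' -AA' -scalemxAl -scalemxAr xA !scaler0.
  have /XP[y ey] : (t *: x') *m A' = 0 by rewrite -scalemxAl.
  have tum := maximal_complM hm tm um.
  exists (loc_frac hm 1 (t * u) *: map_mx loc_inj y).
  rewrite -scalemxAl -map_mxM -ey map_mxZ -xx' !scalerA -mulrA -rmorphM /=.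
  by rewrite loc_inj_unit // scale1r.
have XA' : X *m A' = 0.
  apply/row_matrixP => i; rewrite row_mul row0; apply/XP.
  by exists (delta_mx 0 i); rewrite rowE.
have XA0 : map_mx loc_inj X *m A = 0.
  have e : loc_inj s *: (map_mx loc_inj X *m A) = 0.
    by rewrite scalemxAr AA' -map_mxM XA' map_mx0.
  apply/matrixP => i j; apply: (loc_inj_regular sm).
  by move/matrixP/(_ i j): e; rewrite !mxE mulr0.
by rewrite -mulmxA XA0 mulmx0.
Qed.

Section Nakayama.

Variables (k : nat) (g : 'I_k -> R).
Hypothesis gm : generates_ideal g m.

Lemma one_add_ideal (c : R) : c \in m -> 1 + c \notin m.
Proof.
case: hm => -[m0 m1' mD] _ cm; apply: contra m1' => c1.
by rewrite -[1](addrK c) addrC -mulN1r; apply: mD.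
Qed.

(** The ideal generated by m and t is strictly larger than m, so by maximality
    it contains 1. *)
Lemma comaximal (t : R) : t \notin m -> exists r c, c \in m /\ 1 = r * t + c.
Proof.
case: hm => -[m0 _ mD] hmax tm.
pose J : {pred R} :=
  fun x => `[< exists r c, c \in m /\ x = r * t + c >].
have inJ x : reflect (exists r c, c \in m /\ x = r * t + c) (x \in J).
  exact: asboolP.
apply/inJ; apply: contraT => J1.
have mJ : {subset m <= J}.
  by move=> x xm; apply/inJ; exists 0, x; rewrite mul0r add0r.
have tJ : t \in J by apply/inJ; exists 1, 0; rewrite mul1r addr0.
have Jid : idealr_closed J.
  split=> //; first exact: mJ.
  move=> a x y /inJ[r [c [cm ->]]] /inJ[r' [c' [cm' ->]]]; apply/inJ.
  exists (a * r + r'), (a * c + c'); split; first exact: mD.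
  by ring.
by move: tm; rewrite -(hmax J Jid mJ) tJ.
Qed.

Definition nakayama_mx (p q : nat) (A : 'M[R]_(p, q)) (b : 'rV[R]_q)
  : 'M[R]_(p + k, q) := col_mx A ((\col_i g i) *m b).

Lemma mul_nakayama_mx (p q : nat) (A : 'M[R]_(p, q)) (b : 'rV[R]_q)
    (y : 'rV[R]_(p + k)) :
  y *m nakayama_mx A b =
    lsubmx y *m A + (\sum_i y 0 (rshift p i) * g i) *: b.
Proof.
rewrite /nakayama_mx -{1}[y]hsubmxK mul_row_col mulmxA; congr (_ + _).
rewrite [X in X *m b]mx11_scalar mul_scalar_mx; congr (_ *: _).
by rewrite !mxE; apply: eq_bigr => i _; rewrite !mxE.
Qed.

(** Effective form of Nakayama's lemma: solvability over the localization is
    solvability over R of a system with k more rows. *)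
Lemma loc_row_sub_nakayama (p q : nat) (A : 'M[R]_(p, q)) (b : 'rV[R]_q) :
  (exists x : 'rV[L]_p, map_mx loc_inj b = x *m map_mx loc_inj A) <->
  (exists y, b = y *m nakayama_mx A b).
Proof.
rewrite loc_row_sub; split=> [[t tm [y e]]|[y e]].
  have [r [c [/gm[a ca] e1]]] := comaximal tm.
  exists (row_mx (r *: y) (\row_i a i)).
  rewrite mul_nakayama_mx row_mxKl -scalemxAl -e scalerA.
  rewrite (eq_bigr (fun i => a i * g i)); last first.
    by move=> i _; rewrite row_mxEr mxE.
  by rewrite -ca -scalerDl -e1 scale1r.
exists (1 + - \sum_i y 0 (rshift p i) * g i).
  apply: one_add_ideal; apply/gm; exists (fun i => - y 0 (rshift p i)).
  by rewrite -sumrN; apply: eq_bigr => i _; rewrite mulNr.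
exists (lsubmx y); rewrite scalerBl scale1r {1}e mul_nakayama_mx.
by rewrite addrK.
Qed.

(** The coefficients of the rows g_i b add up to an element of m, which is
    moved to the left-hand side to form the denominator t. *)
Lemma nakayama_solution (p q : nat) (A : 'M[R]_(p, q)) (b : 'rV[R]_q)
    (T : 'rV[R]_(p + k)) (t := 1 + \sum_i T 0 (rshift p i) * g i) :
  T *m nakayama_mx A b + b = 0 ->
  t \notin m /\ lsubmx T *m A + t *: b = 0.
Proof.
rewrite mul_nakayama_mx => e; split.
  by apply: one_add_ideal; apply/gm; exists (fun i => T 0 (rshift p i)).
by rewrite -e -addrA scalerDl scale1r [b + _]addrC.
Qed.

End Nakayama.

End Fractions.

(** * Right linear systems by transposition *)

Section Transpose.

Definition trcode (a : nat) : nat :=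
  mxcode (mxcols a) (mxrows a) (fun i j => mxentry a j i).

Lemma recursive_trcode : recursive1 trcode.
Proof. by rewrite /trcode; recfun. Qed.
#[local] Hint Resolve recursive_trcode : recfun.

Lemma codes_trcode (R : pzRingType) (nu : nat -> R) a p q (A : 'M[R]_(p, q)) :
  codes_mx nu a A -> codes_mx nu (trcode a) A^T.
Proof.
rewrite /trcode => /codes_mxP[-> -> aA].
by apply: codes_mxcode => i j; rewrite aA mxE.
Qed.

Variables (R : comPzRingType) (nu : nat -> R).

Lemma right_syzygies_tr p q n (A : 'M[R]_(p, q)) (X : 'M[R]_(n, q)) :
  left_syzygies_generators A^T X -> right_syzygies_generators A X^T.
Proof.
move=> XP x; rewrite -[A *m x]trmxK trmx_mul.
split=> [/(congr1 trmx)|[y xy]].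
  rewrite trmxK trmx0 => /XP[y e].
  by exists y^T; rewrite -trmx_mul -e trmxK.
suff -> : x^T *m A^T = 0 by rewrite trmx0.
by apply/XP; exists y^T; rewrite xy trmx_mul trmxK.
Qed.

Lemma right_decide_zero_tr p q n (A : 'M[R]_(p, q)) (B : 'M[R]_(p, n)) N T :
  left_decide_zero A^T B^T N T -> right_decide_zero A B N^T T^T.
Proof.
move=> [-> NP]; split; first by rewrite linearD /= trmx_mul !trmxK.
move=> j [x e]; rewrite -tr_row NP ?trmx0 //.
by exists x^T; rewrite -trmx_mul -e tr_col.
Qed.

Lemma right_computable_tr : left_computable nu -> right_computable nu.
Proof.
move=> [[f fr fP] [g [h [gr hr ghP]]]]; split.
  exists (fun a => trcode (f (trcode a))); first by recfun.
  move=> p q A a /codes_trcode aA; have [n [X [XP cX]]] := fP _ _ _ _ aA.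
  exists n, X^T; split; first exact: right_syzygies_tr.
  exact: codes_trcode.
exists (fun a b => trcode (g (trcode a) (trcode b))).
exists (fun a b => trcode (h (trcode a) (trcode b))).
split; [by recfun|by recfun|].
move=> p q n A B a b /codes_trcode aA /codes_trcode bB.
have [N [T [NT cN cT]]] := ghP _ _ _ _ _ _ _ aA bB.
by exists N^T, T^T; split; [exact: right_decide_zero_tr|exact: codes_trcode..].
Qed.

End Transpose.

(** * The algorithms on codes *)

Section Algorithms.

Variables (R : comNzRingType) (nu : nat -> R).
Variables (m : {pred R}) (hm : maximal_ideal m).
Variables (k : nat) (g : 'I_k -> R).
Hypothesis gm : generates_ideal g m.

Variables (zero one : nat) (gens : nat).
Hypotheses (nu0 : nu zero = 0) (nu1 : nu one = 1).
Hypothesis gensP : forall i : 'I_k, nu (entry gens i) = g i.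

Variables (add mul : nat -> nat -> nat) (opp : nat -> nat)
  (cmp : nat -> nat -> nat).
Hypotheses (add_rec : recursive2 add) (mul_rec : recursive2 mul)
  (opp_rec : recursive1 opp) (cmp_rec : recursive2 cmp).
Hypotheses (nuD : forall a b, nu (add a b) = nu a + nu b)
  (nuM : forall a b, nu (mul a b) = nu a * nu b)
  (nuN : forall a, nu (opp a) = - nu a)
  (nuE : forall a b, cmp a b = 0%N <-> nu a = nu b).

Variable syz : nat -> nat.
Hypothesis syz_rec : recursive1 syz.
Hypothesis syzP : forall p q (A : 'M[R]_(p, q)) a, codes_mx nu a A ->
  exists n (X : 'M[R]_(n, p)),
    left_syzygies_generators A X /\ codes_mx nu (syz a) X.

Variables dzn dzt : nat -> nat -> nat.
Hypotheses (dzn_rec : recursive2 dzn) (dzt_rec : recursive2 dzt).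
Hypothesis dzP :
  forall p q n (A : 'M[R]_(p, q)) (B : 'M[R]_(n, q)) a b,
  codes_mx nu a A -> codes_mx nu b B ->
  exists (N : 'M[R]_(n, q)) (T : 'M[R]_(n, p)),
    [/\ left_decide_zero A B N T, codes_mx nu (dzn a b) N
      & codes_mx nu (dzt a b) T].

Local Notation L := (localization hm).
Local Notation mu := (frac_numbering hm nu).

Lemma fold_upto_sum n F :
  nu (fold_upto add zero n F) = \sum_(i < n) nu (F i).
Proof.
elim: n => [|n IH]; first by rewrite big_ord0.
by rewrite big_ord_recr /= nuD IH.
Qed.

Lemma fold_upto_prod n F :
  nu (fold_upto mul one n F) = \prod_(i < n) nu (F i).
Proof.
elim: n => [|n IH]; first by rewrite big_ord0.
by rewrite big_ord_recr /= nuM IH.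
Qed.

Lemma fold_upto_addn n F : fold_upto addn 0 n F = (\sum_(i < n) F i)%N.
Proof.
elim: n => [|n IH]; first by rewrite big_ord0.
by rewrite big_ord_recr /= IH.
Qed.

Definition nakayama_code (a b : nat) : nat :=
  mxcode (mxrows a + k) (mxcols a)
    (fun i j => if (i < mxrows a)%N then mxentry a i j
                else mul (entry gens (i - mxrows a)) (mxentry b 0 j)).

Lemma recursive_nakayama_code : recursive2 nakayama_code.
Proof. by rewrite /nakayama_code; recfun. Qed.
#[local] Hint Resolve recursive_nakayama_code : recfun.

Lemma codes_nakayama p q (A : 'M[R]_(p, q)) (b : 'rV[R]_q) a c :
  codes_mx nu a A -> codes_mx nu c b ->
  codes_mx nu (nakayama_code a c) (nakayama_mx g A b).
Proof.
rewrite /nakayama_code => /codes_mxP[-> -> aA] /codes_mxP[_ _ cb].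
apply: codes_mxcode => i j; case: (splitP i) => i' ii'.
  have -> : i = lshift k i' by apply: val_inj.
  by rewrite /nakayama_mx col_mxEu /= aA.
have -> : i = rshift p i' by apply: val_inj.
rewrite /nakayama_mx col_mxEd /= addKn nuM gensP.
by rewrite (cb 0 j) !mxE big_ord1 mxE.
Qed.

(** A sum of comparisons with 0, hence 0 exactly when the remainder of c
    modulo the rows of the extended matrix vanishes. *)
Definition span_defect (a c : nat) : nat :=
  fold_upto addn 0 (mxcols a)
    (fun j => cmp (mxentry (dzn (nakayama_code a c) c) 0 j) zero).

Definition span_coeff (a c i : nat) : nat :=
  mxentry (dzt (nakayama_code a c) c) 0 i.

Definition span_denom (a c : nat) : nat :=
  add one (fold_upto add zero k (fun i =>
    mul (span_coeff a c (mxrows a + i)) (entry gens i))).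

Lemma recursive_span_defect : recursive2 span_defect.
Proof. by rewrite /span_defect; recfun. Qed.
#[local] Hint Resolve recursive_span_defect : recfun.

Lemma recursive_span_coeff : recursive3 span_coeff.
Proof. by rewrite /span_coeff; recfun. Qed.
#[local] Hint Resolve recursive_span_coeff : recfun.

Lemma recursive_span_denom : recursive2 span_denom.
Proof. by rewrite /span_denom; recfun. Qed.
#[local] Hint Resolve recursive_span_denom : recfun.

Lemma span_defect_eq0 p q (A : 'M[R]_(p, q)) (b : 'rV[R]_q) a c N :
  codes_mx nu a A -> codes_mx nu (dzn (nakayama_code a c) c) N ->
  span_defect a c = 0%N <-> N = 0 :> 'rV[R]_q.
Proof.
move=> /codes_mxP[_ aq _] /codes_mxP[_ _ cN].
rewrite /span_defect fold_upto_addn aq; split=> [/eqP|N0].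
  rewrite sum_nat_eq0 => /forallP N0; apply/rowP => j.
  have /eqP/nuE := N0 j.
  by rewrite (cN 0 j) nu0 mxE.
apply/eqP; rewrite sum_nat_eq0; apply/forallP => j; apply/eqP/nuE.
by rewrite (cN 0 j) N0 nu0 mxE.
Qed.

Lemma span_defectP p q (A : 'M[R]_(p, q)) (b : 'rV[R]_q) a c :
  codes_mx nu a A -> codes_mx nu c b ->
  span_defect a c = 0%N <-> exists x : 'rV[L]_p,
    map_mx (loc_inj hm) b = x *m map_mx (loc_inj hm) A.
Proof.
move=> aA cb; have nA := codes_nakayama aA cb.
have [N [T [[NE NP] cN cT]]] := dzP nA cb.
rewrite (span_defect_eq0 b aA cN) (loc_row_sub_nakayama hm gm).
split=> [N0|[y e]].
  exists (- T); rewrite mulNmx; apply/eqP.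
  by rewrite -subr_eq0 opprK addrC -NE N0.
by rewrite -(row_id 0 N) NP // row_id; exists y.
Qed.

Lemma span_solution p q (A : 'M[R]_(p, q)) (b : 'rV[R]_q) a c
    (t := nu (span_denom a c)) :
  codes_mx nu a A -> codes_mx nu c b -> span_defect a c = 0%N ->
  t \notin m /\ (\row_j nu (span_coeff a c j)) *m A + t *: b = 0.
Proof.
move=> aA cb; have nA := codes_nakayama aA cb.
have [N [T [[NE NP] cN cT]]] := dzP nA cb.
move=> /(span_defect_eq0 b aA cN) N0.
have [ar aq _] := codes_mxP aA; have [_ _ tT] := codes_mxP cT.
have TE (i : 'I_(p + k)) : nu (span_coeff a c i) = T 0 i by apply: (tT 0).
have [] := nakayama_solution hm gm (etrans (esym NE) N0).
have -> : 1 + \sum_i T 0 (rshift p i) * g i = t.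
  rewrite /t /span_denom nuD nu1 fold_upto_sum ar; congr (1 + _).
  by apply: eq_bigr => i _; rewrite nuM gensP -TE.
have -> : lsubmx T = \row_j nu (span_coeff a c j).
  by apply/rowP => j; rewrite !mxE -TE.
by [].
Qed.

Definition scalar_code (c : nat) : nat := mxcode 1 1 (fun _ _ => c).

Lemma recursive_scalar_code : recursive1 scalar_code.
Proof. by rewrite /scalar_code; recfun. Qed.
#[local] Hint Resolve recursive_scalar_code : recfun.

Lemma codes_scalar c : codes_mx nu (scalar_code c) ((nu c)%:M : 'M_1).
Proof. by apply: codes_mxcode => i j; rewrite !ord1 mxE. Qed.

(** An element s is outside m iff 1 lies in the row space of the 1 x 1 matrix
    (s) over the localization, that is, iff s becomes a unit there. *)
Definition unit_defect (c : nat) : nat :=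
  span_defect (scalar_code c) (scalar_code one).

Lemma recursive_unit_defect : recursive1 unit_defect.
Proof. by rewrite /unit_defect; recfun. Qed.
#[local] Hint Resolve recursive_unit_defect : recfun.

Lemma unit_defectP c : unit_defect c = 0%N <-> nu c \notin m.
Proof.
rewrite (span_defectP (codes_scalar c) (codes_scalar one)).
rewrite loc_row_sub nu1; split=> [[t tm [y]]|cm].
  move/matrixP/(_ 0 0); rewrite !mxE big_ord1 !mxE !mulr1n mulr1 => e.
  apply: contra tm; rewrite e => cm; case: hm => -[m0 _ mD] _.
  by rewrite -[_ * _]addr0; apply: mD.
exists (nu c) => //; exists 1%:M.
by rewrite mul1mx scale_scalar_mx mulr1.
Qed.

(** Any natural number is a code, and a fraction whose denominator lies in m
    stands for 0.  Replacing such a fraction by 0 / 1 leaves its value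
    unchanged and makes every denominator admissible. *)
Definition num (c : nat) : nat :=
  if unit_defect (entry c 1) == 0%N then entry c 0 else zero.
Definition den (c : nat) : nat :=
  if unit_defect (entry c 1) == 0%N then entry c 1 else one.

Lemma recursive_num : recursive1 num.
Proof. by rewrite /num; recfun. Qed.
Lemma recursive_den : recursive1 den.
Proof. by rewrite /den; recfun. Qed.
#[local] Hint Resolve recursive_num recursive_den : recfun.

Lemma nu_den c : nu (den c) \notin m.
Proof.
rewrite /den; case: eqP => [/unit_defectP //|_].
by rewrite nu1 (maximal_compl1 hm).
Qed.

Lemma mu_num_den c : mu c = loc_frac hm (nu (num c)) (nu (den c)).
Proof.
rewrite /frac_numbering /num /den -/(entry c 0) -/(entry c 1).
case: eqP => // /unit_defectP cm; rewrite nu0 nu1 -[RHS]/(loc_inj hm 0).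
by rewrite loc_inj0 /loc_frac insubN //; apply/negP.
Qed.

Definition frac_code (a b : nat) : nat := CodeSeq.code [:: a; b].

Lemma recursive_frac_code : recursive2 frac_code.
Proof. by rewrite /frac_code; recfun. Qed.
#[local] Hint Resolve recursive_frac_code : recfun.

Lemma mu_frac a b : mu (frac_code a b) = loc_frac hm (nu a) (nu b).
Proof. by rewrite /frac_numbering CodeSeq.codeK. Qed.

Lemma mu_inj a : mu (frac_code a one) = loc_inj hm (nu a).
Proof. by rewrite mu_frac nu1. Qed.

(** Two fractions are equal iff the difference of the cross products lies in
    the row space, over the localization, of the matrix with no rows. *)
Definition loc_cmp (c d : nat) : nat :=
  span_defect (mxcode 0 1 (fun _ _ => zero))
    (scalar_code (add (mul (num c) (den d)) (opp (mul (den c) (num d))))).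

Lemma loc_cmpP c d : loc_cmp c d = 0%N <-> mu c = mu d.
Proof.
have c0 : codes_mx nu (mxcode 0 1 (fun _ _ => zero)) (0 : 'M[R]_(0, 1)).
  by apply: codes_mxcode => -[].
rewrite (span_defectP c0 (codes_scalar _)) !mu_num_den.
rewrite loc_frac_eq_inj ?nu_den // nuD nuN !nuM.
split=> [[x]|e]; last by exists 0; rewrite mul0mx map_scalar_mx /= e raddf0.
by rewrite map_mx0 mulmx0 map_scalar_mx => /matrixP/(_ 0 0); rewrite !mxE.
Qed.

Lemma loc_effective_arithmetic :
  (forall r, exists c, nu c = r) -> effective_arithmetic mu.
Proof.
move=> nu_onto; split.
- move=> x; have [r [s [sm ->]]] := loc_fracP x.
  have [a <-] := nu_onto r; have [b <-] := nu_onto s.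
  by exists (frac_code a b); rewrite mu_frac.
- exists (fun c d => frac_code
    (add (mul (num c) (den d)) (mul (num d) (den c))) (mul (den c) (den d))).
    by recfun.
  by move=> c d; rewrite mu_frac !mu_num_den loc_fracD ?nu_den // nuD !nuM.
- exists (fun c => frac_code (opp (num c)) (den c)); first by recfun.
  by move=> c; rewrite mu_frac !mu_num_den loc_fracN ?nu_den // nuN.
- exists (fun c d => frac_code (mul (num c) (num d)) (mul (den c) (den d))).
    by recfun.
  by move=> c d; rewrite mu_frac !mu_num_den loc_fracM ?nu_den // !nuM.
exists loc_cmp; last exact: loc_cmpP.
by rewrite /loc_cmp; recfun.
Qed.

Definition common_den (a : nat) : nat :=
  fold_upto mul one (mxrows a * mxcols a) (fun n => den (entry a n.+2)).

(** In the product over all flat indices, the numerator replaces the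
    denominator at the index of the entry. *)
Definition cleared (a : nat) : nat :=
  mxcode (mxrows a) (mxcols a) (fun i j =>
    fold_upto mul one (mxrows a * mxcols a) (fun n =>
      if n == (i * mxcols a + j)%N
      then num (entry a n.+2) else den (entry a n.+2))).

Lemma recursive_common_den : recursive1 common_den.
Proof. by rewrite /common_den; recfun. Qed.
Lemma recursive_cleared : recursive1 cleared.
Proof. by rewrite /cleared; recfun. Qed.
#[local] Hint Resolve recursive_common_den recursive_cleared : recfun.

Lemma common_den_compl a : nu (common_den a) \notin m.
Proof.
by rewrite fold_upto_prod; apply: (loc_compl_prod hm) => i; exact: nu_den.
Qed.

Lemma codes_cleared p q (A : 'M[L]_(p, q)) a : codes_mx mu a A ->
  exists2 A', codes_mx nu (cleared a) A' &
    loc_inj hm (nu (common_den a)) *: A = map_mx (loc_inj hm) A'.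
Proof.
move=> /codes_mxP[ar aq aA].
pose F (i j : nat) := fold_upto mul one (p * q) (fun n =>
  if n == (i * q + j)%N then num (entry a n.+2) else den (entry a n.+2)).
exists (\matrix_(i, j) nu (F i j)).
  by rewrite /cleared ar aq; apply: codes_mxcode => i j; rewrite mxE.
apply/matrixP => i j; rewrite !mxE -aA mu_num_den.
rewrite !fold_upto_prod ar aq /mxentry aq.
have ijpq : (i * q + j < p * q)%N.
  apply: (@leq_trans (i * q + q)%N); first by rewrite ltn_add2l.
  by rewrite -mulSnr leq_mul2r ltn_ord orbT.
have := @loc_common_denominator _ _ hm _
  (fun n : 'I_(p * q) => nu (num (entry a n.+2)))
  (fun n : 'I_(p * q) => nu (den (entry a n.+2))) (Ordinal ijpq).
move=> /= -> //; last by move=> n; exact: nu_den.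
by congr (loc_inj hm _); apply: eq_bigr => n _; rewrite -val_eqE /=; case: eqP.
Qed.

Definition loc_syz (a : nat) : nat :=
  mxcode (mxrows (syz (cleared a))) (mxcols (syz (cleared a)))
    (fun i j => frac_code (mxentry (syz (cleared a)) i j) one).

Lemma loc_syzP p q (A : 'M[L]_(p, q)) a : codes_mx mu a A ->
  exists n (X : 'M[L]_(n, p)),
    left_syzygies_generators A X /\ codes_mx mu (loc_syz a) X.
Proof.
move=> /codes_cleared[A' cA' AA']; have [n [X [XP cX]]] := syzP cA'.
exists n, (map_mx (loc_inj hm) X); split.
  exact: loc_syzygies (common_den_compl a) AA' XP.
rewrite /loc_syz; have [-> -> xX] := codes_mxP cX.
by apply: codes_mxcode => i j; rewrite mu_inj xX mxE.
Qed.

Lemma recursive_loc_syz : recursive1 loc_syz.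
Proof. by rewrite /loc_syz; recfun. Qed.

Definition row_code (b i : nat) : nat :=
  mxcode 1 (mxcols b) (fun _ j => mxentry b i j).

Lemma recursive_row_code : recursive2 row_code.
Proof. by rewrite /row_code; recfun. Qed.
#[local] Hint Resolve recursive_row_code : recfun.

Lemma codes_row_code p q (B : 'M[R]_(p, q)) b (i : 'I_p) :
  codes_mx nu b B -> codes_mx nu (row_code b i) (row i B).
Proof.
rewrite /row_code => /codes_mxP[_ -> bB].
by apply: codes_mxcode => i' j; rewrite mxE bB.
Qed.

Definition row_solvable (a b i : nat) : bool :=
  span_defect (cleared a) (row_code (cleared b) i) == 0%N.

Definition loc_dzn (a b : nat) : nat :=
  mxcode (mxrows b) (mxcols b) (fun i j =>
    if row_solvable a b i then frac_code zero one else mxentry b i j).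

(** With s A and u B the cleared matrices and w, t the solution over R for a
    row of u B, w (s A) + t (u B) = 0; hence the coefficients s w / (u t). *)
Definition loc_dzt (a b : nat) : nat :=
  mxcode (mxrows b) (mxrows a) (fun i j =>
    if row_solvable a b i then
      frac_code
        (mul (common_den a)
             (span_coeff (cleared a) (row_code (cleared b) i) j))
        (mul (common_den b)
             (span_denom (cleared a) (row_code (cleared b) i)))
    else frac_code zero one).

Lemma recursive_loc_dzn : recursive2 loc_dzn.
Proof. by rewrite /loc_dzn /row_solvable; recfun. Qed.

Lemma recursive_loc_dzt : recursive2 loc_dzt.
Proof. by rewrite /loc_dzt /row_solvable; recfun. Qed.

Lemma loc_dzP p q n (A : 'M[L]_(p, q)) (B : 'M[L]_(n, q)) a b :
  codes_mx mu a A -> codes_mx mu b B ->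
  exists (N : 'M[L]_(n, q)) (T : 'M[L]_(n, p)),
    [/\ left_decide_zero A B N T, codes_mx mu (loc_dzn a b) N
      & codes_mx mu (loc_dzt a b) T].
Proof.
move=> aA bB.
have [A' cA' AA'] := codes_cleared aA.
have [B' cB' BB'] := codes_cleared bB.
have am := common_den_compl a; have bm := common_den_compl b.
set s := nu (common_den a) in am AA'; set u := nu (common_den b) in bm BB'.
have [ar aq _] := codes_mxP aA; have [br bq bBE] := codes_mxP bB.
pose t (i : nat) := nu (span_denom (cleared a) (row_code (cleared b) i)).
pose w (i j : nat) :=
  nu (span_coeff (cleared a) (row_code (cleared b) i) j).
have rowZ i (c : L) : row i (c *: B) = c *: row i B.
  by apply/rowP => j; rewrite !mxE.
pose N : 'M[L]_(n, q) :=
  \matrix_(i, j) if row_solvable a b i then 0 else B i j.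
pose T : 'M[L]_(n, p) := \matrix_(i, j)
  if row_solvable a b i then loc_frac hm (s * w i j) (u * t i) else 0.
exists N, T.
split; last 1 first.
- rewrite /loc_dzt br ar; apply: codes_mxcode => i j; rewrite mxE.
  by case: ifP => _; rewrite ?mu_inj ?nu0 ?loc_inj0 // mu_frac !nuM.
- rewrite /left_decide_zero; split.
    apply/row_matrixP => i; rewrite linearD /= row_mul.
    have cBi := codes_row_code i cB'.
    case: (boolP (row_solvable a b i)) => ri; last first.
      have -> : row i T = 0.
        by apply/rowP => j; rewrite !mxE (negPf ri).
      rewrite mul0mx add0r; apply/rowP => j.
      by rewrite !mxE (negPf ri).
    have [tm e] := span_solution cA' cBi (eqP ri).
    have utm : u * t i \notin m by apply: maximal_complM.
    have -> : row i T =
        (loc_frac hm 1 (u * t i) * loc_inj hm s) *: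
        map_mx (loc_inj hm) (\row_(j < p) w i j).
      apply/rowP => j; rewrite !mxE ri -mulrA -rmorphM /=.
      by rewrite /loc_inj loc_fracM ?(maximal_compl1 hm) // mul1r mulr1.
    have -> : row i N = 0.
      by apply/rowP => j; rewrite !mxE ri.
    rewrite -scalemxAl -scalerA scalemxAr AA' -map_mxM.
    move: e => /eqP; rewrite addr_eq0 => /eqP ->.
    rewrite map_mxN map_mxZ map_row -BB' rowZ scalerN !scalerA -/(t i).
    by rewrite -mulrA -rmorphM [t i * u]mulrC loc_inj_unit // scale1r addNr.
  (* a solvable row of B would give a solvable row of the cleared matrix *)
  move=> i [x e]; apply/rowP => j; rewrite !mxE.
  case: ifP => // /negP[]; apply/eqP.
  apply/(span_defectP cA' (codes_row_code i cB')).
  exists ((loc_inj hm u * loc_frac hm 1 s) *: x).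
  rewrite map_row -BB' rowZ e -AA' -scalemxAl -scalemxAr scalerA.
  by rewrite -mulrA loc_inj_unit // mulr1.
- rewrite /loc_dzn br bq; apply: codes_mxcode => i j; rewrite mxE -bBE.
  by case: ifP => _; rewrite ?mu_inj ?nu0 ?loc_inj0.
Qed.

Lemma loc_left_computable : left_computable mu.
Proof.
split; first by exists loc_syz; [exact: recursive_loc_syz|exact: loc_syzP].
exists loc_dzn, loc_dzt; split; [| |exact: loc_dzP].
  exact: recursive_loc_dzn.
exact: recursive_loc_dzt.
Qed.

End Algorithms.

Theorem theorem4p1 (R : comNzRingType) (nu : nat -> R)
  (k : nat) (g : 'I_k -> R) (m : {pred R}) (hm : maximal_ideal m) :
  generates_ideal g m ->
  computable_ring nu ->
  computable_ring (frac_numbering hm nu).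
Proof.
move=> gm [[nu_onto [add add_rec nuD] [opp opp_rec nuN] [mul mul_rec nuM]]].
move=> [cmp cmp_rec nuE].
move=> [[syz syz_rec syzP] [dzn [dzt [dzn_rec dzt_rec dzP]]]] _.
have [zero nu0] := nu_onto 0; have [one nu1] := nu_onto 1.
have [c cP] := choice (fun i => nu_onto (g i)).
pose gens := CodeSeq.code [seq c i | i <- enum 'I_k].
have gensP (i : 'I_k) : nu (entry gens i) = g i.
  rewrite entry_code (nth_map i) ?size_enum_ord //.
  by rewrite nth_ord_enum cP.
have lc : left_computable (frac_numbering hm nu).
  exact: (loc_left_computable hm gm nu0 nu1 gensP add_rec mul_rec cmp_rec
            nuD nuM nuE syz_rec syzP dzn_rec dzt_rec dzP).
split=> //; last exact: right_computable_tr.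
exact: (loc_effective_arithmetic hm gm nu0 nu1 gensP add_rec mul_rec opp_rec
          cmp_rec nuD nuM nuN nuE dzn_rec dzP).
Qed.
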